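(* Let $\alpha>0$, $\beta>0$, $\gamma\ge 0$, $0\le\phi\le1$. Each of the following parameter conditions is sufficient for the left-pushed beta density $x\mapsto\text{LPushBeta}(x|\alpha,\beta,\gamma,\phi)$ to be strictly quasi-concave or strictly quasi-convex over its support, as stated: (a) if $\alpha\ge 1$ and $\beta>1$, it is strictly quasi-concave; (b) if $\alpha>1$ and $\beta\ge 1$, it is strictly quasi-concave; (c) if $\alpha\ge 1$, $\beta\ge 1$, $\gamma>0$ and $\phi>0$, it is strictly quasi-concave; (d) if $\alpha\le 1$ and $\beta+\gamma\phi^2<1$, it is strictly quasi-convex; (e) if $\alpha\le 1$, $\beta<1$, $0<\phi<1$ and $\gamma$ is sufficiently small (i.e. there is $\gamma_*>0$ depending on $\alpha,\beta,\phi$ such that this holds for all $0\le\gamma<\gamma_*$), it is strictly quasi-convex.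
   Context: For $\alpha>0$, $\beta>0$, $\gamma\ge 0$, $0\le\phi\le 1$, the left-pushed beta density is $$\text{LPushBeta}(x|\alpha,\beta,\gamma,\phi)=\frac{x^{\alpha-1}(1-x)^{\beta-1}(1-x\phi)^{\gamma}}{\int_0^1 t^{\alpha-1}(1-t)^{\beta-1}(1-t\phi)^{\gamma}\,dt},\qquad 0\le x\le 1.$$ Its support is the unit interval; values at the endpoints $0$ and $1$ are understood as limits in $[0,+\infty]$. A function $f$ is strictly quasi-concave if $f(\lambda x+(1-\lambda)y)>\min(f(x),f(y))$ for all $x\ne y$ and $0<\lambda<1$, and strictly quasi-convex if $f(\lambda x+(1-\lambda)y)<\max(f(x),f(y))$ for all $x\neq y$ and $0<\lambda<1$. *)

(* Defs.v *)
From HB Require Import structures.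
From mathcomp Require Import all_boot all_order all_algebra.
From mathcomp Require Import all_classical all_reals all_analysis.

Set Implicit Arguments.
Unset Strict Implicit.
Unset Printing Implicit Defensive.

Import Order.TTheory GRing.Theory Num.Theory.
Import numFieldNormedType.Exports.

Local Open Scope classical_set_scope.
Local Open Scope ring_scope.

(* The convention for [powR] at base 0 is immaterial below: the kernel is
   evaluated at 0 and 1 only under the integral, on a null set. *)
Definition lpush_kernel (R : realType) (alpha beta gamma phi x : R) : R :=
  x `^ (alpha - 1) * (1 - x) `^ (beta - 1) * (1 - x * phi) `^ gamma.

Definition lpush_norm (R : realType) (alpha beta gamma phi : R) : R :=
  \int[lebesgue_measure]_(t in `[0, 1]) lpush_kernel alpha beta gamma phi t.

Definition lpush_formula (R : realType) (alpha beta gamma phi x : R) : R :=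
  lpush_kernel alpha beta gamma phi x / lpush_norm alpha beta gamma phi.

(* The values at 0 and 1 are the one-sided limits taken in the extended reals,
   possibly +oo; the density vanishes off the unit interval. *)
Definition LPushBeta (R : realType) (alpha beta gamma phi x : R) : \bar R :=
  if x == 0 then
    lim ((lpush_formula alpha beta gamma phi t)%:E @[t --> (0 : R)^'+])
  else if x == 1 then
    lim ((lpush_formula alpha beta gamma phi t)%:E @[t --> (1 : R)^'-])
  else if 0 < x < 1 then (lpush_formula alpha beta gamma phi x)%:E
  else 0%:E.

Definition strictly_quasi_concave_on (R : realType) (A : set R)
    (f : R -> \bar R) : Prop :=
  forall x y lambda : R, A x -> A y -> x <> y -> 0 < lambda < 1 ->
    (Order.min (f x) (f y) < f (lambda * x + (1 - lambda) * y)%R)%E.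

Definition strictly_quasi_convex_on (R : realType) (A : set R)
    (f : R -> \bar R) : Prop :=
  forall x y lambda : R, A x -> A y -> x <> y -> 0 < lambda < 1 ->
    (f (lambda * x + (1 - lambda) * y)%R < Order.max (f x) (f y))%E.

(* Main.v *)
Require Import Defs.
From mathcomp Require Import all_boot all_order all_algebra.
From mathcomp Require Import all_classical all_reals all_analysis.
From mathcomp Require Import measurable_realfun ring lra.

(* On ]0, 1[ the logarithm of the density has derivative
     (alpha - 1) / x - (beta - 1) / (1 - x) - gamma phi / (1 - x phi),
   which is strictly decreasing in cases (a)-(c) and strictly increasing in case
   (d); by the mean value theorem the density is then strictly quasi-concave,
   resp. quasi-convex, on the open interval. The endpoint limits need not be
   computed: a strictly quasi-concave function on ]a, b[ is monotone near a and
   near b, so the limits exist in the extended reals, and strict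
   quasi-concavity passes to [a, b]. The normalizing integral must be shown
   finite and nonzero, since a divergent one would be read as 0. Case (e) is
   case (d) with gamma_star = (1 - beta) / phi ^ 2. *)

Import Order.TTheory GRing.Theory Num.Theory.
Import numFieldNormedType.Exports.

Local Open Scope classical_set_scope.
Local Open Scope ring_scope.

(** * Strict quasi-concavity along ordered triples of points *)

(** The codomain is any total order, so that the same notion serves the real-valued logarithm and
    the extended-real density; quasi-convexity is handled by negation. *)
Definition min_lt_between {d : Order.disp_t} {T : orderType d} {R : realType}
    (i : interval R) (f : R -> T) :=
  forall x z y, x \in i -> y \in i -> x < z -> z < y ->
    (f x < f z)%O || (f y < f z)%O.

Lemma min_lt_between_sqc (R : realType) (i : interval R) (f : R -> \bar R) :
  min_lt_between i f -> strictly_quasi_concave_on [set` i] f.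
Proof.
move=> fmin x y l /= xi yi xy /andP[l0 l1]; rewrite gt_min.
have [xlty|yltx|/xy//] := ltgtP x y.
- by apply: fmin => //; nra.
- by rewrite orbC; apply: fmin => //; nra.
Qed.

Lemma min_lt_between_sqcvx (R : realType) (i : interval R) (f : R -> \bar R) :
  min_lt_between i (\- f)%E -> strictly_quasi_convex_on [set` i] f.
Proof.
move=> fmin x y l /= xi yi xy /andP[l0 l1]; rewrite lt_max.
rewrite -(lteN2 (f x)) -(lteN2 (f y)).
have [xlty|yltx|/xy//] := ltgtP x y.
- by apply: fmin => //; nra.
- by rewrite orbC; apply: fmin => //; nra.
Qed.

(** * Existence of the endpoint limits and passage to the closed interval *)

Section endpoint_limits.
Context {R : realType}.
Implicit Types (f : R -> \bar R) (a b : R).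

(* If f increases once, it increases all the way from the left endpoint;
   otherwise it is nonincreasing: either way it is monotone near a. *)
Lemma min_lt_between_at_right_is_cvg f a b : a < b ->
  min_lt_between `]a, b[ f -> cvg (f x @[x --> a^'+]).
Proof.
move=> ab fmin.
have [[s [t [/andP[sa st] tb fst]]]|noinc] := pselect (exists s t,
    [/\ a < s < t, t < b & (f s < f t)%E]).
  (* The later, larger value at [t] forces everything left of [s] below [f s]; the same argument
     with [s] as far point then orders any two points left of [s]. *)
  have fxs x : a < x -> x < s -> (f x < f s)%E.
    move=> ax xs; have /orP[//|ft] : (f x < f s)%E || (f t < f s)%E.
    - by apply: fmin => //; rewrite ?in_itv/=; lra.
    - by have := lt_trans fst ft; rewrite ltxx.
  apply: nondecreasing_at_right_is_cvge; near=> u => x y.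
  have us : u < s by near: u; exact: nbhs_right_lt.
  rewrite !in_itv/= => /andP[ax xu] /andP[ay yu].
  rewrite le_eqVlt => /predU1P[->//|xy].
  have fys : (f y < f s)%E by apply: fxs => //; lra.
  have /orP[|fsy] : (f x < f y)%E || (f s < f y)%E.
  - by apply: fmin => //; rewrite ?in_itv/=; lra.
  - exact: ltW.
  - by have := lt_trans fys fsy; rewrite ltxx.
apply: nonincreasing_at_right_is_cvge; near=> u => x y.
have ub : u < b by near: u; exact: nbhs_right_lt.
rewrite !in_itv/= => /andP[ax xu] /andP[ay yu].
rewrite le_eqVlt => /predU1P[->//|xy].
rewrite leNgt; apply/negP => fxy; apply: noinc.
by exists x, y; split; rewrite ?ax//; lra.
Unshelve. all: by end_near. Qed.

(** By contraposition: if [f z <= f y], then [f] stays below [f z] on []a, z[] and hence increases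
    there. The limit at [a] is thus at most [f m] for an intermediate [m], which keeps it strictly
    below [f z]. *)
Lemma min_lt_between_gt_right f a b z y : a < b ->
  min_lt_between `]a, b[ f -> a < z -> z < y -> y < b ->
  (f z <= lim (f x @[x --> a^'+]))%E -> (f y < f z)%E.
Proof.
move=> ab fmin az zy yb; apply: contraTT; rewrite -leNgt -ltNge => fzy.
have fz x : a < x -> x < z -> (f x < f z)%E.
  move=> ax xz; have /orP[//|] : (f x < f z)%E || (f y < f z)%E.
    by apply: fmin => //; rewrite ?in_itv/=; lra.
  by move/(le_lt_trans fzy); rewrite ltxx.
have [m /andP[am mz]] : exists m, a < m < z.
  by exists ((a + z) / 2); rewrite !midf_lt.
apply: le_lt_trans (fz m am mz).
apply: lime_le; first exact: min_lt_between_at_right_is_cvg fmin.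
near=> x.
have ax : a < x by near: x; exact: nbhs_right_gt.
have xm : x < m by near: x; exact: nbhs_right_lt.
have fxz : (f m < f z)%E by exact: fz.
have /orP[|fzm] : (f x < f m)%E || (f z < f m)%E.
- by apply: fmin => //; rewrite ?in_itv/=; lra.
- exact: ltW.
- by have := lt_trans fxz fzm; rewrite ltxx.
Unshelve. all: by end_near. Qed.

(** Reflection exchanges the endpoints, so that left limits at [b] reduce to right limits at
    [- b]. *)
Lemma min_lt_between_opp f a b :
  min_lt_between `]a, b[ f -> min_lt_between `](- b), (- a)[ (f \o -%R).
Proof.
move=> fmin x z y; rewrite !in_itv/= => /andP[bx xa] /andP[by_ ya] xz zy.
rewrite orbC; apply: fmin; rewrite ?in_itv/=; lra.
Qed.

Lemma at_left_opp f b : f x @[x --> b^'-] = (f \o -%R) x @[x --> (- b)^'+].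
Proof.
rewrite at_rightN; apply/seteqP; split => A; rewrite /= /nbhs/= /fmap/=;
  by apply: filterS => x /=; rewrite opprK.
Qed.

Lemma min_lt_between_at_left_is_cvg f a b : a < b ->
  min_lt_between `]a, b[ f -> cvg (f x @[x --> b^'-]).
Proof.
move=> ab /min_lt_between_opp fmin; rewrite at_left_opp.
by apply: min_lt_between_at_right_is_cvg fmin; rewrite ltrN2.
Qed.

Lemma min_lt_between_gt_left f a b z y : a < b ->
  min_lt_between `]a, b[ f -> a < y -> y < z -> z < b ->
  (f z <= lim (f x @[x --> b^'-]))%E -> (f y < f z)%E.
Proof.
move=> ab /min_lt_between_opp fmin ay yz zb; rewrite at_left_opp => flim.
have := @min_lt_between_gt_right _ _ _ (- z) (- y) _ fmin.
by rewrite /= !opprK; apply => //; lra.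
Qed.

(** If exactly one of the outer points is an endpoint, either its limit is below [f z], or [f z] is
    at most that limit and the preceding one-sided lemmas put the other outer value below [f z]. *)
Lemma min_lt_between_closure f F a b : a < b ->
  min_lt_between `]a, b[ f ->
  F a = lim (f x @[x --> a^'+]) -> F b = lim (f x @[x --> b^'-]) ->
  {in `]a, b[, F =1 f} -> min_lt_between `[a, b] F.
Proof.
move=> ab fmin Fa Fb Ff x z y; rewrite !in_itv/= => /andP[ax xb] /andP[ay yb].
move=> xz zy.
have az : a < z by lra.
have zb : z < b by lra.
rewrite (Ff z) ?in_itv/= ?az//.
move: ax yb; rewrite le_eqVlt => /predU1P[ax|ax]; rewrite le_eqVlt;
    move=> /predU1P[yb'|yb'].
(* Both outer points are endpoints. If neither limit were below [f z], then [f] would drop below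
   [f z] right of [z] and keep decreasing past [m], so its limit at [b] would be at most
   [f m < f z]. *)
- rewrite -ax yb' Fa Fb -[_ || _]negbK negb_or -!leNgt.
  apply/negP => /andP[fza fzb].
  have fgt y' : z < y' -> y' < b -> (f y' < f z)%E.
    by move=> zy' y'b; exact: (@min_lt_between_gt_right f a b).
  have [m /andP[zm mb]] : exists m, z < m < b.
    by exists ((z + b) / 2); rewrite !midf_lt.
  have fmz := fgt m zm mb.
  suff : (lim (f x @[x --> b^'-]) <= f m)%E.
    by move=> /(le_trans fzb)/le_lt_trans/(_ fmz); rewrite ltxx.
  apply: lime_le; first exact: min_lt_between_at_left_is_cvg fmin.
  near=> u.
  have mu : m < u by near: u; exact: nbhs_left_gt.
  have ub : u < b by near: u; exact: nbhs_left_lt.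
  have /orP[fzm|] : (f z < f m)%E || (f u < f m)%E.
  + by apply: fmin => //; rewrite ?in_itv/=; lra.
  + by have := lt_trans fmz fzm; rewrite ltxx.
  + exact: ltW.
- rewrite -ax Fa (Ff y) ?in_itv/= ?yb' ?andbT; last by lra.
  case: ltP => //= fza; exact: (@min_lt_between_gt_right f a b).
- rewrite yb' Fb (Ff x) ?in_itv/= ?ax ?andTb; last by lra.
  rewrite orbC; case: ltP => //= fza; exact: (@min_lt_between_gt_left f a b).
- rewrite (Ff x) ?(Ff y); [|by rewrite in_itv/=; lra..].
  by apply: fmin => //; rewrite in_itv/=; lra.
Unshelve. all: by end_near. Qed.

End endpoint_limits.

(** * A derivative criterion for strict quasi-concavity *)

(** The mean slope over [[x, z]] exceeds the one over [[z, y]], so either the first is positive or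
    the second is negative. *)
Lemma derive_decr_min_lt_between (R : realType) (h dh : R -> R) (a b : R) :
  {in `]a, b[, forall x : R, is_derive x 1 h (dh x)} ->
  {in `]a, b[ &, {homo dh : x y /~ x < y}} ->
  min_lt_between `]a, b[ h.
Proof.
move=> hdh dhdecr x z y; rewrite !in_itv/= => /andP[ax xb] /andP[ay yb] xz zy.
have mvt u v : a < u -> u < v -> v < b ->
    exists2 c, u < c < v & h v - h u = dh c * (v - u).
  move=> au uv vb.
  have hdh' : {in `[u, v], forall w : R, is_derive w 1 h (dh w)}.
    by move=> w; rewrite in_itv/= => uwv; apply: hdh; rewrite in_itv/=; lra.
  have hc : {within `[u, v], continuous h}.
    by apply: derivable_within_continuous => w /hdh' [].
  have hoo w : w \in `]u, v[ -> is_derive w 1 h (dh w).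
    by rewrite in_itv/= => /andP[uw wv]; apply: hdh'; rewrite in_itv/= !ltW.
  have [c] := MVT uv hoo hc.
  by rewrite in_itv/= => ucv hcE; exists c.
have [c1 /andP[xc1 c1z] e1] := mvt x z ax xz (lt_trans zy yb).
have [c2 /andP[zc2 c2y] e2] := mvt z y (lt_trans ax xz) zy yb.
have dlt : dh c2 < dh c1.
  by apply: dhdecr; rewrite ?in_itv/=; lra.
rewrite -[X in X || _]subr_gt0 -[X in _ || X]subr_lt0 e1 e2.
rewrite pmulr_lgt0 ?subr_gt0// pmulr_llt0 ?subr_gt0//.
have [//|c1le] := ltP 0 (dh c1).
exact: lt_le_trans c1le.
Qed.

(** * Monotonicity of the logarithmic derivative of the kernel *)

Section kernel_shape.
Context {R : realType}.
Implicit Types alpha beta gamma phi x : R.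

Definition lpush_log alpha beta gamma phi x : R :=
  (alpha - 1) * ln x + (beta - 1) * ln (1 - x) + gamma * ln (1 - x * phi).

Definition lpush_log' alpha beta gamma phi x : R :=
  (alpha - 1) / x - (beta - 1) / (1 - x) - gamma * phi / (1 - x * phi).

Lemma lpush_kernelE alpha beta gamma phi x : phi <= 1 -> x \in `]0, 1[ ->
  lpush_kernel alpha beta gamma phi x =
  expR (lpush_log alpha beta gamma phi x).
Proof.
rewrite in_itv/= => phi1 /andP[x0 x1].
have x1' : 0 < 1 - x by lra.
have xp : 0 < 1 - x * phi by nra.
by rewrite /lpush_kernel /powR !gt_eqF// /lpush_log !expRD.
Qed.

Lemma lpush_kernel_ge0 alpha beta gamma phi x :
  0 <= lpush_kernel alpha beta gamma phi x.
Proof. by rewrite /lpush_kernel !mulr_ge0 ?powR_ge0. Qed.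

Lemma is_derive_lpush_log alpha beta gamma phi : phi <= 1 ->
  {in `]0, 1[, forall x : R, is_derive x 1
    (lpush_log alpha beta gamma phi) (lpush_log' alpha beta gamma phi x)}.
Proof.
move=> phi1 x; rewrite in_itv/= => /andP[x0 x1].
have x1' : 0 < 1 - x by lra.
have xp : 0 < 1 - x * phi by nra.
have d1 : is_derive x 1 (@ln R) x^-1 by exact: is_derive1_ln.
have d2 : is_derive x 1 (fun y : R => 1 - y) (-1).
  by apply: is_derive_eq; rewrite /GRing.scale/=; ring.
have d3 : is_derive x 1 (fun y : R => 1 - y * phi) (- phi).
  by apply: is_derive_eq; rewrite /GRing.scale/=; ring.
have d4 := @is_derive1_comp R (@ln R) (fun y => 1 - y) x _ _
  (is_derive1_ln x1') d2.
have d5 := @is_derive1_comp R (@ln R) (fun y => 1 - y * phi) x _ _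
  (is_derive1_ln xp) d3.
have d := is_deriveD (is_deriveD (is_deriveZ (alpha - 1) d1)
  (is_deriveZ (beta - 1) d4)) (is_deriveZ gamma d5).
apply: (is_derive_eq d).
by rewrite /lpush_log' /GRing.scale/=; ring.
Qed.

(** This exact factorization replaces a second derivative: monotonicity is read off the signs of the
    three summands. *)
Lemma lpush_log'B alpha beta gamma phi x y : phi <= 1 ->
  x \in `]0, 1[ -> y \in `]0, 1[ ->
  lpush_log' alpha beta gamma phi x - lpush_log' alpha beta gamma phi y =
  (y - x) * ((alpha - 1) / (x * y) + (beta - 1) / ((1 - x) * (1 - y))
    + gamma * phi ^+ 2 / ((1 - x * phi) * (1 - y * phi))).
Proof.
rewrite !in_itv/= => phi1 /andP[x0 x1] /andP[y0 y1].
have x1' : 0 < 1 - x by lra.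
have xp : 0 < 1 - x * phi by nra.
have y1' : 0 < 1 - y by lra.
have yp : 0 < 1 - y * phi by nra.
by rewrite /lpush_log'; field; rewrite !gt_eqF.
Qed.

(** All three summands of [lpush_log'B] are nonnegative, and the alternatives of the disjunction,
    which come from cases (b), (a) and (c) in this order, each make one of them positive. *)
Lemma lpush_log'_decr alpha beta gamma phi : 0 <= gamma -> 0 <= phi <= 1 ->
  1 <= alpha -> 1 <= beta ->
  [|| 1 < alpha, 1 < beta | (0 < gamma) && (0 < phi)] ->
  {in `]0, 1[ &, {homo lpush_log' alpha beta gamma phi : x y /~ x < y}}.
Proof.
move=> g0 /andP[p0 p1] a1 b1 strict x y xi yi yx.
rewrite -subr_gt0 lpush_log'B// pmulr_rgt0 ?subr_gt0//.
move: xi yi; rewrite !in_itv/= => /andP[x0 x1] /andP[y0 y1].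
have A0 : 0 < (y * x)^-1 by rewrite invr_gt0 mulr_gt0.
have B0 : 0 < ((1 - y) * (1 - x))^-1.
  by rewrite invr_gt0 mulr_gt0// subr_gt0.
have C0 : 0 < ((1 - y * phi) * (1 - x * phi))^-1.
  by rewrite invr_gt0 mulr_gt0//; nra.
move: A0 B0 C0; set A := (_)^-1; set B := (_)^-1; set C := (_)^-1 => A0 B0 C0.
have Aa : 0 <= (alpha - 1) * A by rewrite mulr_ge0 ?subr_ge0// ltW.
have Bb : 0 <= (beta - 1) * B by rewrite mulr_ge0 ?subr_ge0// ltW.
have Cc : 0 <= gamma * phi ^+ 2 * C.
  by rewrite !mulr_ge0 ?sqr_ge0// ltW.
case/or3P : strict => [a1'|b1'|/andP[g0' p0']].
- have : 0 < (alpha - 1) * A by rewrite mulr_gt0 ?subr_gt0.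
  lra.
- have : 0 < (beta - 1) * B by rewrite mulr_gt0 ?subr_gt0.
  lra.
- have : 0 < gamma * phi ^+ 2 * C by rewrite !mulr_gt0 ?exprn_gt0.
  lra.
Qed.

Lemma lpush_log'_incr alpha beta gamma phi : 0 <= gamma -> 0 <= phi <= 1 ->
  alpha <= 1 -> beta + gamma * phi ^+ 2 < 1 ->
  {in `]0, 1[ &, {homo lpush_log' alpha beta gamma phi : x y / x < y}}.
Proof.
move=> g0 /andP[p0 p1] a1 bg x y xi yi xy.
rewrite -subr_lt0 lpush_log'B// pmulr_rlt0 ?subr_gt0//.
move: xi yi; rewrite !in_itv/= => /andP[x0 x1] /andP[y0 y1].
have A0 : 0 < (x * y)^-1 by rewrite invr_gt0 mulr_gt0.
have B0 : 0 < ((1 - x) * (1 - y))^-1.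
  by rewrite invr_gt0 mulr_gt0// subr_gt0.
(* Since phi <= 1, the pole of the gamma term is no stronger than that of the
   beta term, so beta < 1 - gamma * phi ^ 2 lets the latter absorb it. *)
have CB : ((1 - x * phi) * (1 - y * phi))^-1 <= ((1 - x) * (1 - y))^-1.
  rewrite lef_pV2 ?posrE ?mulr_gt0 ?subr_gt0//; [|nra|nra].
  by apply: ler_pM; nra.
move: A0 B0 CB; set A := (_)^-1; set B := (_)^-1; set C := (_)^-1 => A0 B0 CB.
have Aa : (alpha - 1) * A <= 0 by rewrite mulr_le0_ge0 ?subr_le0// ltW.
have Cc : gamma * phi ^+ 2 * C <= gamma * phi ^+ 2 * B.
  by rewrite ler_wpM2l// mulr_ge0 ?sqr_ge0.
have : (beta + gamma * phi ^+ 2 - 1) * B < 0 by rewrite pmulr_llt0 ?subr_lt0.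
lra.
Qed.

End kernel_shape.

(** * Finiteness and positivity of the normalizing integral *)

Section normalization.
Context {R : realType}.
Notation mu := (@lebesgue_measure R).

(** Exhaust []a, b[] by closed intervals [I n]: the fundamental theorem of calculus bounds each
    integral through the bounded antiderivative [F], and monotone convergence passes to the
    union. *)
Lemma ge0_itvoo_integral_lty (f F : R -> R) (a b M : R) :
  {in `]a, b[, forall x, 0 <= f x} -> {in `]a, b[, continuous f} ->
  {in `]a, b[, forall x : R, is_derive x 1 F (f x)} ->
  {in `]a, b[, forall x, `|F x| <= M} ->
  (\int[mu]_(x in `]a, b[) (f x)%:E < +oo)%E.
Proof.
move=> f0 cf dF FM.
have [e [e0 e_ni e_small]] : exists e : nat -> R, [/\ forall n, 0 < e n,
    forall m n, (m <= n)%N -> e n <= e m &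
    forall d, 0 < d -> exists n, e n < d].
  exists (fun n => n.+1%:R^-1); split => [n|m n mn|d d0].
  - by rewrite invr_gt0.
  - by rewrite lef_pV2 ?posrE// ler_nat.
  - have [n _ nd] := near_infty_natSinv_lt (PosNum d0).
    by exists n; exact: nd (leqnn n).
pose I n := `[a + e n, b - e n]%classic : set R.
have Isub n : I n `<=` `]a, b[.
  move=> x; rewrite /I/= !in_itv/= => /andP[ax xb].
  by have := e0 n; lra.
have Iab : `]a, b[%classic = \bigcup_n I n.
  apply/seteqP; split => [x|x [n _ /Isub//]].
  rewrite /= in_itv/= => /andP[ax xb].
  have m0 : 0 < Num.min (x - a) (b - x) by rewrite lt_min !subr_gt0 ax.
  have [n] := e_small _ m0; rewrite lt_min => /andP[h1 h2].
  by exists n => //; rewrite /I/= in_itv/=; lra.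
have mf : measurable_fun `]a, b[ f.
  by apply: open_continuous_measurable_fun => // x; rewrite inE; exact: cf.
have Ind : nondecreasing_seq I.
  move=> m n mn; rewrite subsetEset => x; rewrite /I/= !in_itv/=.
  by have := e_ni m n mn; lra.
have mI n : measurable (I n) by exact: measurable_itv.
have mfI n : measurable_fun (I n) (EFin \o f).
  by apply/measurable_EFinP; exact: measurable_funS (Isub n) mf.
have f0I n x : I n x -> (0 <= (EFin \o f) x)%E.
  by move=> /Isub xab; rewrite lee_fin; exact: f0.
rewrite Iab.
have /cvg_lim <- // := @ge0_nondecreasing_set_cvg_integral _
  (measurableTypeR R) _ I (EFin \o f) mu Ind mI mfI f0I.
(* The absolute value makes the bound nonnegative, as needed for those [I n] that are empty or a
   single point. *)
apply: (@le_lt_trans _ _ (`|M| + `|M|)%:E); last exact: ltry.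
apply: lime_le.
  apply: ereal_nondecreasing_is_cvgn.
  exact: ge0_nondecreasing_set_nondecreasing_integral.
apply: nearW => n.
have [uv|] := ltP (a + e n) (b - e n); last first.
  rewrite le_eqVlt => /predU1P[vu|vu].
    by rewrite /I vu set_itv1 integral_set1 lee_fin addr_ge0.
  by rewrite /I set_itv_ge ?integral_set0 ?lee_fin ?addr_ge0// bnd_simp -ltNge.
have Imem x : x \in `[a + e n, b - e n] -> x \in `]a, b[.
  exact: Isub.
rewrite /I (@continuous_FTC2 _ f F)//.
- rewrite -EFinB lee_fin (le_trans (ler_norm _))// (le_trans (ler_normB _ _))//.
  by rewrite lerD// (le_trans (FM _ _) (ler_norm _))//; apply: Imem;
    rewrite in_itv/= lexx ltW.
- by apply: continuous_in_subspaceT => x /set_mem/Imem; exact: cf.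
- have cF x : x \in `[a + e n, b - e n] -> {for x, continuous F}.
    by move=> /Imem/dF[dFx _]; exact/differentiable_continuous/derivable1_diffP.
  split=> [x xab||].
  + by have [] : is_derive x 1 F (f x) by apply/dF/Imem/subset_itv_oo_cc.
  + by apply: cvg_at_right_filter; apply: cF; rewrite in_itv/= lexx ltW.
  + by apply: cvg_at_left_filter; apply: cF; rewrite in_itv/= lexx ltW.
- move=> x xab; rewrite derive1E.
  by have [_ ->] : is_derive x 1 F (f x) by apply/dF/Imem/subset_itv_oo_cc.
Qed.

(** On this range the logarithm of [s] is at most [ln 2] in absolute value, which bounds [p * ln s]
    whatever the sign of [p]. *)
Lemma powR_half_le (s p : R) : 2^-1 <= s <= 1 -> s `^ p <= 2 `^ `|p|.
Proof.
move=> /andP[s2 s1]; have s0 : 0 < s by apply: lt_le_trans s2; rewrite invr_gt0.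
rewrite /powR !gt_eqF// ler_expR.
have lns : `|ln s| <= ln 2.
  rewrite ler0_norm ?ln_le0// -lnV ?posrE// ler_ln ?posrE ?invr_gt0//.
  by rewrite -[leRHS]invrK lef_pV2 ?posrE ?invr_gt0.
by rewrite (le_trans (ler_norm _))// normrM ler_wpM2l.
Qed.

(* On each half of ]0, 1[, the power that is not singular there is at most
   2 ^ |exponent|. *)
Lemma lpush_kernel_le (alpha beta gamma phi : R) :
  0 <= gamma -> 0 <= phi <= 1 ->
  {in `]0, 1[, forall x, lpush_kernel alpha beta gamma phi x <=
    (2 `^ `|alpha - 1| + 2 `^ `|beta - 1|) *
    (x `^ (alpha - 1) + (1 - x) `^ (beta - 1))}.
Proof.
move=> g0 /andP[p0 p1] x; rewrite in_itv/= => /andP[x0 x1].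
have g1 : (1 - x * phi) `^ gamma <= 1.
  have pow1 : 1 `^ gamma = 1 by rewrite powR1.
  rewrite -[leRHS]pow1; apply: ge0_ler_powR; rewrite ?nnegrE//; nra.
rewrite /lpush_kernel (le_trans (ler_piMr _ g1)) ?mulr_ge0 ?powR_ge0//.
have A0 := powR_ge0 x (alpha - 1); have B0 := powR_ge0 (1 - x) (beta - 1).
have P0 := powR_ge0 2 `|alpha - 1|; have Q0 := powR_ge0 2 `|beta - 1|.
have [x2|/ltW x2] := leP x 2^-1.
- have : (1 - x) `^ (beta - 1) <= 2 `^ `|beta - 1|.
    by apply: powR_half_le; lra.
  by nra.
- have : x `^ (alpha - 1) <= 2 `^ `|alpha - 1|.
    by apply: powR_half_le; lra.
  by nra.
Qed.

(** Both powers have explicit antiderivatives, collected in [F], which are bounded on the unit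
    interval because [alpha] and [beta] are positive. *)
Lemma beta_dominator_integral_lty (alpha beta C : R) :
  0 < alpha -> 0 < beta -> 0 <= C ->
  (\int[mu]_(x in `]0%R, 1%R[)
    (C * (x `^ (alpha - 1) + (1 - x) `^ (beta - 1)))%:E < +oo)%E.
Proof.
move=> a0 b0 C0.
pose F (x : R) := C * (alpha^-1 * x `^ alpha - beta^-1 * (1 - x) `^ beta).
have dpow (p x : R) : 0 < x -> is_derive x 1 (@powR R ^~ p) (p * x `^ (p - 1)).
  exact: is_derive1_powR.
have d1 (x : R) : is_derive x 1 (fun y : R => 1 - y) (-1).
  by apply: is_derive_eq; rewrite /GRing.scale/=; ring.
apply: (@ge0_itvoo_integral_lty _ F 0 1 (C * (alpha^-1 + beta^-1))).
- by move=> x _; rewrite mulr_ge0// addr_ge0// powR_ge0.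
- move=> x; rewrite in_itv/= => /andP[x0 x1].
  have x1' : 0 < 1 - x by rewrite subr_gt0.
  have dx := @is_derive1_comp R (@powR R ^~ (beta - 1)) _ x _ _
    (dpow _ _ x1') (d1 x).
  have [dd _] := is_deriveZ C (is_deriveD (dpow (alpha - 1) x x0) dx).
  exact/differentiable_continuous/derivable1_diffP.
- move=> x; rewrite in_itv/= => /andP[x0 x1].
  have x1' : 0 < 1 - x by rewrite subr_gt0.
  have dx := @is_derive1_comp R (@powR R ^~ beta) _ x _ _ (dpow _ _ x1') (d1 x).
  have d := is_deriveZ C (is_deriveB (is_deriveZ alpha^-1 (dpow alpha x x0))
    (is_deriveZ beta^-1 dx)).
  apply: (is_derive_eq d); rewrite /GRing.scale/=.
  by field; rewrite !gt_eqF.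
- move=> x; rewrite in_itv/= => /andP[x0 x1].
  have le1 (p y : R) : 0 < p -> 0 < y < 1 -> 0 <= p^-1 * y `^ p <= p^-1.
    move=> p0 /andP[y0 y1]; rewrite mulr_ge0 ?powR_ge0 ?invr_ge0 ?(ltW p0)//=.
    rewrite ler_piMr ?invr_ge0 ?(ltW p0)//.
    have pow1 : 1 `^ p = 1 by rewrite powR1.
    rewrite -[leRHS]pow1.
    by apply: ge0_ler_powR; rewrite ?nnegrE// ltW.
  rewrite normrM (ger0_norm C0) ler_wpM2l//.
  have := le1 alpha x a0; have := le1 beta (1 - x) b0.
  rewrite x0 x1 => /(_ _)/andP[|B0 B1]; first by lra.
  move=> /(_ isT)/andP[A0 A1].
  by rewrite ler_norml; lra.
Qed.

Lemma measurable_powR_1subM (p q : R) :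
  measurable_fun setT (fun x : R => (1 - x * q) `^ p).
Proof.
apply: (measurableT_comp (measurable_powR p)).
by apply: measurable_funB => //; exact: measurable_funM.
Qed.

Lemma measurable_powR_onem (p : R) :
  measurable_fun setT (fun x : R => (1 - x) `^ p).
Proof.
by have := measurable_powR_1subM p 1; under eq_fun do rewrite mulr1.
Qed.

Lemma measurable_lpush_kernel (alpha beta gamma phi : R) :
  measurable_fun setT (lpush_kernel alpha beta gamma phi).
Proof.
apply: measurable_funM; last exact: measurable_powR_1subM.
by apply: measurable_funM; [exact: measurable_powR|exact: measurable_powR_onem].
Qed.

Lemma lpush_norm_gt0 (alpha beta gamma phi : R) : 0 < alpha -> 0 < beta ->
  0 <= gamma -> 0 <= phi <= 1 -> 0 < lpush_norm alpha beta gamma phi.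
Proof.
move=> a0 b0 g0 p01; have /andP[p0 p1] := p01.
set K := lpush_kernel alpha beta gamma phi.
have mK : measurable_fun setT (EFin \o K).
  by apply/measurable_EFinP; exact: measurable_lpush_kernel.
have mKoo : measurable_fun (`]0, 1[%classic : set R) (EFin \o K).
  exact: measurable_funTS.
have K0 x : (0 <= (K x)%:E)%E by rewrite lee_fin lpush_kernel_ge0.
(* Dropping the null set of endpoints leaves a domain on which the kernel is an exponential. *)
rewrite /lpush_norm /Rintegral (integral_itv_bndoo _ _ mKoo).
apply: fine_gt0; apply/andP; split.
(* A nonnegative function with zero integral vanishes off a null set [N]. The kernel vanishes
   nowhere on []0, 1[], so [N] would contain an interval of length 1. *)
- rewrite lt_neqAle; apply/andP; split; last first.
    by apply: integral_ge0 => x _; exact: K0.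
  apply/eqP => /esym intK0.
  have /ae_eq_integral_abs : (\int[mu]_(x in `]0%R, 1%R[) `|(K x)%:E| = 0)%E.
    by rewrite -intK0; apply: eq_integral => x _; rewrite gee0_abs.
  move=> /(_ _ mKoo)-[//|N [mN N0 subN]].
  have : (mu `]0%R, 1%R[ <= mu N)%E.
    apply: le_measure; rewrite ?inE//; apply: subset_trans subN => x x01 /=.
    move=> /(_ x01)/= [] /eqP.
    by rewrite /K lpush_kernelE// gt_eqF// expR_gt0.
  by rewrite N0 lebesgue_measure_itv/= lte_fin ltr01 oppr0 adde0 lee_fin ler10.
(* [C] is the constant of [lpush_kernel_le]. *)
- pose C : R := 2 `^ `|alpha - 1| + 2 `^ `|beta - 1|.
  apply: le_lt_trans (@beta_dominator_integral_lty alpha beta C a0 b0 _).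
    apply: ge0_le_integral => //.
    + move=> x _; exact: K0.
    + apply: measurable_funTS; apply/measurable_EFinP.
      apply: measurable_funM => //; apply: measurable_funD.
      * exact: measurable_powR.
      * exact: measurable_powR_onem.
    + move=> x x01; rewrite [X in (X <= _)%E]/= lee_fin.
      exact: lpush_kernel_le.
  by rewrite addr_ge0 ?powR_ge0.
Qed.

End normalization.

(** * From the logarithm of the kernel to the density *)

Section density_shape.
Context {R : realType}.
Variables alpha beta gamma phi : R.
Hypotheses (alpha_gt0 : 0 < alpha) (beta_gt0 : 0 < beta).
Hypotheses (gamma_ge0 : 0 <= gamma) (phi01 : 0 <= phi <= 1).

Let phi_le1 : phi <= 1. Proof. by case/andP : phi01. Qed.

Let g := lpush_formula alpha beta gamma phi.
Let h := lpush_log alpha beta gamma phi.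
Let h' := lpush_log' alpha beta gamma phi.

(** The exponential and division by a positive constant preserve strict order, so the shape of [g]
    is that of [h]. *)
Lemma lpush_formula_mono :
  {in `]0, 1[ &, forall x y, (g x < g y) = (h x < h y)}.
Proof.
move=> x y x01 y01; rewrite /g /lpush_formula !lpush_kernelE//.
by rewrite ltr_pM2r ?ltr_expR// invr_gt0 lpush_norm_gt0.
Qed.

Let LPushBetaE : {in `]0, 1[, LPushBeta alpha beta gamma phi =1 EFin \o g}.
Proof.
move=> x; rewrite in_itv/= /LPushBeta => x01; have /andP[x0 x1] := x01.
by rewrite gt_eqF// lt_eqF// x01.
Qed.

Let mem_itvoo01 (x y z : R) : x \in `]0, 1[ -> y \in `]0, 1[ ->
  x < z -> z < y -> z \in `]0, 1[.
Proof. by rewrite !in_itv/=; lra. Qed.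

Lemma LPushBeta_sqc : {in `]0, 1[ &, {homo h' : x y /~ x < y}} ->
  strictly_quasi_concave_on `[0, 1] (LPushBeta alpha beta gamma phi).
Proof.
move=> h'_decr; apply: min_lt_between_sqc.
have hmin : min_lt_between `]0, 1[ h.
  by apply: derive_decr_min_lt_between h'_decr; exact: is_derive_lpush_log.
apply: (@min_lt_between_closure _ (EFin \o g)) => //.
- move=> x z y x01 y01 xz zy /=.
  have z01 := mem_itvoo01 _ _ _ x01 y01 xz zy.
  by rewrite !lte_fin !lpush_formula_mono//; exact: hmin.
- by rewrite /LPushBeta eqxx.
- by rewrite /LPushBeta oner_eq0 eqxx.
Qed.

Lemma LPushBeta_sqcvx : {in `]0, 1[ &, {homo h' : x y / x < y}} ->
  strictly_quasi_convex_on `[0, 1] (LPushBeta alpha beta gamma phi).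
Proof.
move=> h'_incr; apply: min_lt_between_sqcvx.
have hmin : min_lt_between `]0, 1[ (\- h).
  apply: (@derive_decr_min_lt_between _ _ (\- h')).
  - move=> x x01.
    exact: is_deriveN (is_derive_lpush_log alpha beta gamma phi phi_le1 x x01).
  - by move=> x y x01 y01 xy /=; rewrite ltrN2; exact: h'_incr.
have gmin : min_lt_between `]0, 1[ (\- (EFin \o g))%E.
  move=> x z y x01 y01 xz zy /=.
  have z01 := mem_itvoo01 _ _ _ x01 y01 xz zy.
  have := hmin _ _ _ x01 y01 xz zy.
  by rewrite /= !lte_fin !ltrN2 !lpush_formula_mono.
(* Exchanging negation and limit with [limeN] requires convergence of [g], whereas quasi-concavity
   yields that of its negative; a second negation bridges the two. *)
have cvgK (F : set_system R) : Filter F ->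
    cvg ((\- (EFin \o g))%E x @[x --> F]) -> cvg ((g x)%:E @[x --> F]).
  have <- : (\- (\- (EFin \o g)))%E = (fun x => (g x)%:E).
    by apply/funext => x; rewrite /= opprK.
  by move=> FF; exact: is_cvgeN.
apply: (min_lt_between_closure _ _ _ _ ltr01 gmin).
- rewrite /LPushBeta eqxx limeN//; apply: cvgK.
  exact: min_lt_between_at_right_is_cvg ltr01 gmin.
- rewrite /LPushBeta oner_eq0 eqxx limeN//; apply: cvgK.
  exact: min_lt_between_at_left_is_cvg ltr01 gmin.
- by move=> x x01 /=; rewrite LPushBetaE.
Qed.

End density_shape.

(** * The five parameter conditions *)

Theorem mainTheorem7 (R : realType) (alpha beta phi : R)
    (alpha_gt0 : 0 < alpha) (beta_gt0 : 0 < beta) (phi01 : 0 <= phi <= 1) :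
  (forall gamma : R, 0 <= gamma ->
     [/\ 1 <= alpha -> 1 < beta ->
           strictly_quasi_concave_on `[0, 1] (LPushBeta alpha beta gamma phi),
         1 < alpha -> 1 <= beta ->
           strictly_quasi_concave_on `[0, 1] (LPushBeta alpha beta gamma phi),
         1 <= alpha -> 1 <= beta -> 0 < gamma -> 0 < phi ->
           strictly_quasi_concave_on `[0, 1] (LPushBeta alpha beta gamma phi)
       & alpha <= 1 -> beta + gamma * phi ^+ 2 < 1 ->
           strictly_quasi_convex_on `[0, 1] (LPushBeta alpha beta gamma phi)])
  /\ (alpha <= 1 -> beta < 1 -> 0 < phi -> phi < 1 ->
       exists2 gamma_star : R, 0 < gamma_star &
         forall gamma : R, 0 <= gamma -> gamma < gamma_star ->
           strictly_quasi_convex_on `[0, 1] (LPushBeta alpha beta gamma phi)).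
Proof.
have /andP[phi_ge0 phi_le1] := phi01.
have convex gamma : 0 <= gamma -> alpha <= 1 -> beta + gamma * phi ^+ 2 < 1 ->
    strictly_quasi_convex_on `[0, 1] (LPushBeta alpha beta gamma phi).
  by move=> *; apply: LPushBeta_sqcvx => //; exact: lpush_log'_incr.
split=> [gamma gamma_ge0|alpha_le1 beta_lt1 phi_gt0 _].
  split=> [a1 b1|a1 b1|a1 b1 g0 p0|]; last exact: convex.
  - apply: LPushBeta_sqc => //; apply: lpush_log'_decr => //; first exact: ltW.
    by rewrite b1 orbT.
  - apply: LPushBeta_sqc => //; apply: lpush_log'_decr => //; first exact: ltW.
    by rewrite a1.
  - apply: LPushBeta_sqc => //; apply: lpush_log'_decr => //.
    by rewrite g0 p0 !orbT.
exists ((1 - beta) / phi ^+ 2) => [|gamma gamma_ge0].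
  by rewrite divr_gt0 ?exprn_gt0// subr_gt0.
rewrite ltr_pdivlMr ?exprn_gt0// => gamma_lt; apply: convex => //.
by rewrite addrC -ltrBrDr.
Qed.
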